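(* Let $X_1,X_2,\ldots$ be positively associated random variables with $E(X_k)\ge0$ for all $k$ and $\sup_i E(X_i^+)<\infty$, and let $S_n=\sum_{i=1}^nX_i$. Then, for every $\varepsilon>0$, $$\frac{\max_{1\le k\le n}(-S_k)^+}{n(\log n)^{1+\varepsilon}}\to0\quad\text{a.s. as } n\to\infty.$$
   Context: $x^+=\max\{0,x\}$. Functions are understood to be Borel measurable. A finite collection $X_1,\ldots,X_n$ of random variables is (positively) associated if $\operatorname{Cov}(f(X_1,\ldots,X_n),g(X_1,\ldots,X_n))\ge0$ for all componentwise nondecreasing functions $f,g$ on $\mathbb{R}^n$ for which the covariance is defined. An infinite collection is associated if every finite subcollection is associated. The $X_k$ are integrable. *)

(* Defs.v *)
From HB Require Import structures.
From mathcomp Require Import all_boot all_order all_algebra.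
From mathcomp Require Import all_classical all_reals all_analysis.

Set Implicit Arguments.
Unset Strict Implicit.
Unset Printing Implicit Defensive.

Import Order.TTheory GRing.Theory Num.Theory.
Import numFieldNormedType.Exports.

Local Open Scope ring_scope.

Definition componentwise_nondecreasing (R : realType) (n : nat)
    (f : n.-tuple R -> R) : Prop :=
  forall u v : n.-tuple R, (forall i, tnth u i <= tnth v i) -> f u <= f v.

(* The sigma-algebra on n.-tuple R is the product one, i.e. the Borel
   sigma-algebra of R^n. The covariance of U and V is defined when U, V and
   U * V are integrable. *)
Definition associated_fin (d : measure_display) (T : measurableType d)
    (R : realType) (P : probability T R) (n : nat) (Y : 'I_n -> T -> R) : Prop :=
  forall f g : n.-tuple R -> R,
    measurable_fun [set: n.-tuple R] f ->
    measurable_fun [set: n.-tuple R] g ->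
    componentwise_nondecreasing f ->
    componentwise_nondecreasing g ->
    let U := fun w => f [tuple Y i w | i < n] in
    let V := fun w => g [tuple Y i w | i < n] in
    U \in Lfun P 1%E -> V \in Lfun P 1%E -> (U * V)%R \in Lfun P 1%E ->
    (0 <= covariance P U V)%E.

Definition associated (d : measure_display) (T : measurableType d)
    (R : realType) (P : probability T R) (X : nat -> T -> R) : Prop :=
  forall (n : nat) (s : 'I_n -> nat), injective s ->
    associated_fin P (fun i => X (s i)).

(* Sequences are indexed from 0: [X i] stands for X_(i+1), so that
   [partial_sum X n] is X_1 + ... + X_n. *)
Definition partial_sum (T : Type) (R : realType) (X : nat -> T -> R) (n : nat)
    (w : T) : R :=
  \sum_(i < n) X i w.

(* All the terms are nonnegative, so the default value 0 of the iterated
   maximum is immaterial for n >= 1. *)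
Definition max_neg_partial_sum (T : Type) (R : realType) (X : nat -> T -> R)
    (n : nat) (w : T) : R :=
  \big[Num.max/0]_(1 <= k < n.+1) (\- partial_sum X k)^\+ w.

(* Main.v *)
Require Import Defs.
From HB Require Import structures.
From mathcomp Require Import all_boot all_order all_algebra.
From mathcomp Require Import all_classical all_reals all_analysis.
From mathcomp Require Import measurable_realfun ring lra.

Set Implicit Arguments.
Unset Strict Implicit.
Unset Printing Implicit Defensive.

Import Order.TTheory GRing.Theory Num.Theory.
Import numFieldNormedType.Exports.

Local Open Scope classical_set_scope.
Local Open Scope ring_scope.

(** Every [- S_k] with [k <= n] is at most the sum [A_n] of the negative parts
    of [X_1, ..., X_n], so it suffices to show that [A_n / (n (ln n)^(1+eps))]
    tends to [0] almost surely.  With [C] the supremum of the [E X_i^+], the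
    hypothesis [E X_i >= 0] gives [E X_i^- <= E X_i^+ <= C]
    ([expectation_funrneg_le]), hence [E A_n <= C n].  For [n = 2^m] the
    quotients [A_n / (n m^(1+eps))] therefore have expectation at most
    [C / m^(1+eps)], which is summable over [m] ([sum_powRN_le]); their sum is
    almost surely finite, so they tend to [0] almost surely
    ([ae_cvg0_of_summable_integrals]).  Since [A_n] is nondecreasing in [n] and
    [n (ln n)^(1+eps)] changes by a bounded factor between consecutive powers
    of two, convergence along powers of two gives convergence along all [n]
    ([cvg0_of_dyadic]). *)

(** The terms are compared with the increments of [- x^(-a) / a], a
    primitive of [x^-(1+a)]. *)
Lemma powRN_le_increment (R : realType) (a x : R) : 0 < a -> 0 < x ->
  ((x + 1) `^ (1 + a))^-1 <= a^-1 * (x `^ (- a) - (x + 1) `^ (- a)).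
Proof.
move=> a0 x0; have x1 : 0 < x + 1 by rewrite addr_gt0.
have xE : x `^ (- a) = (x + 1) `^ (- a) * expR (a * ln ((x + 1) / x)).
  by rewrite /powR !gt_eqF// -expRD ln_div ?posrE//; congr expR; ring.
have lnge : (x + 1)^-1 <= ln ((x + 1) / x).
  have -> : (x + 1) / x = (1 - (x + 1)^-1)^-1 by field; lra.
  have lt1 : (x + 1)^-1 < 1 by rewrite invf_lt1// ltrDr.
  rewrite lnV ?posrE ?subr_gt0//.
  by rewrite lerNr le_ln1Dx// ltrN2.
rewrite ler_pdivlMl// xE -[X in _ - X]mulr1 -mulrBr.
have -> : (x + 1) `^ (1 + a) = (x + 1) * (x + 1) `^ a.
  by rewrite powRD ?(gt_eqF x1) ?implybT// powRr1// ltW.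
rewrite invfM powRN mulrCA mulrA mulrC [in leLHS](mulrC _ a).
rewrite ler_wpM2l ?invr_ge0 ?powR_ge0//.
apply: le_trans (ler_wpM2l (ltW a0) lnge) _.
by rewrite lerBrDl expR_ge1Dx.
Qed.

(** Obtained by telescoping [powRN_le_increment]; the first term is [1]. *)
Lemma sum_powRN_le (R : realType) (a : R) (n : nat) : 0 < a ->
  \sum_(i < n) (i.+1%:R `^ (1 + a))^-1 <= 1 + a^-1 :> R.
Proof.
move=> a0; case: n => [|n].
  by rewrite big_ord0 addr_ge0 ?invr_ge0 ?ltW.
rewrite big_ord_recl powR1 invr1 lerD2l.
suff : \sum_(i < n) (i.+2%:R `^ (1 + a))^-1 <=
       a^-1 * (1 - n.+1%:R `^ (- a)) :> R.
  by move/le_trans; apply; rewrite ler_piMr ?invr_ge0 ?(ltW a0)//.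
elim: n => [|n IHn]; first by rewrite big_ord0 powR1 subrr mulr0.
rewrite big_ord_recr/=.
apply: le_trans (lerD IHn _) _.
  by rewrite -natr1; apply: powRN_le_increment.
by rewrite natr1 -mulrDr addrA subrK.
Qed.

(** The series of the [f m] is integrable, hence almost everywhere finite, and
    the terms of a convergent series tend to [0]. *)
Lemma ae_cvg0_of_summable_integrals (d : measure_display)
    (T : measurableType d) (R : realType) (mu : {measure set T -> \bar R})
    (f : nat -> T -> R) (u : nat -> R) (B : R) :
  (forall m, measurable_fun setT (f m)) -> (forall m w, 0 <= f m w) ->
  (forall m, (\int[mu]_w (f m w)%:E <= (u m)%:E)%E) ->
  (forall n, \sum_(m < n) u m <= B) ->
  {ae mu, forall w, f ^~ w @ \oo --> (0 : R)}.
Proof.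
move=> mf f0 fu uB.
pose F w := (\sum_(m <oo) (f m w)%:E)%E.
have mfE m : measurable_fun setT (EFin \o f m).
  exact/measurable_EFinP.
have F0 w : (0 <= F w)%E by apply: nneseries_ge0 => m _ _; rewrite lee_fin.
have intF : mu.-integrable setT F.
  apply/integrableP; split.
    apply: (ge0_emeasurable_sum (h := fun m => EFin \o f m) (P := xpredT)) => //.
    by move=> m w _ _; rewrite lee_fin.
  under eq_integral do rewrite gee0_abs//.
  rewrite integral_nneseries//; last by move=> m w _; rewrite lee_fin.
  apply: (@le_lt_trans _ _ B%:E); last exact: ltry.
  apply: lime_le.
    by apply: is_cvg_nneseries => m _ _; apply: integral_ge0 => w _; rewrite lee_fin.
  apply: nearW => n; rewrite big_mkord.
  apply: (@le_trans _ _ (\sum_(m < n) (u m)%:E)%E); first exact: lee_sum.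
  by rewrite sumEFin lee_fin.
apply: filterS (integrable_ae measurableT intF) => w /(_ I) Fw.
apply: cvg_series_cvg_0; apply: nondecreasing_is_cvgn.
  exact: nondecreasing_series.
exists (fine (F w)) => _ [n _ <-].
rewrite -lee_fin fineK// /series/= -sumEFin.
by apply: nneseries_lim_ge => m _; rewrite lee_fin.
Qed.

(** If [2^m <= n < 2^(m+1)] with [m >= 1], then [a n <= a (2^(m+1))], while
    [n (ln n)^p] is at least a constant multiple of [2^(m+1) (m+1)^p]. *)
Lemma dyadic_bound (R : realType) (p : R) (a : nat -> R) (m n : nat) :
  0 <= p -> (forall k, 0 <= a k) -> {homo a : i j / (i <= j)%N >-> i <= j} ->
  (0 < m)%N -> (2 ^ m <= n < 2 ^ m.+1)%N ->
  a n / (n%:R * ln n%:R `^ p) <=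
  2 * (2 / ln 2) `^ p * (a (2 ^ m.+1)%N / ((2 ^ m.+1)%:R * m.+1%:R `^ p)).
Proof.
move=> p0 a0 a_homo m0 /andP[mn nm].
have ln2 : 0 < ln 2 :> R by rewrite ln_gt0// ltr1n.
have n1 : (0 < n)%N by rewrite (leq_trans _ mn)// expn_gt0.
have n0 : 0 < n%:R :> R by rewrite ltr0n.
have tm0 : 0 < (2 ^ m)%:R :> R by rewrite ltr0n expn_gt0.
have lnn : m%:R * ln 2 <= ln n%:R :> R.
  rewrite mulr_natl -lnXn// -natrX ler_ln ?posrE//.
  by rewrite ler_nat.
(* Since [m >= 1], [m.+1 <= 2 m]: this is where the constant [2 / ln 2] comes
   from. *)
have ln_lb : m.+1%:R / (2 / ln 2) <= ln n%:R :> R.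
  apply: le_trans lnn; rewrite invf_div mulrCA mulrC.
  rewrite ler_wpM2r ?(ltW ln2)// ler_pdivrMr// -natr1.
  have : 1 <= m%:R :> R by rewrite ler1n.
  lra.
have c0 : 0 < 2 / ln 2 :> R by rewrite divr_gt0.
have mp0 : 0 < m.+1%:R `^ p :> R by rewrite powR_gt0.
have cp0 : 0 < (2 / ln 2) `^ p :> R by rewrite powR_gt0.
have ln_lbp : m.+1%:R `^ p / (2 / ln 2) `^ p <= ln n%:R `^ p :> R.
  have lnn0 : 0 <= ln n%:R :> R by rewrite ln_ge0// ler1n.
  rewrite ler_pdivrMr// -powRM ?(ltW c0)//.
  apply: ge0_ler_powR; rewrite ?nnegrE//; first by rewrite mulr_ge0// ltW.
  by rewrite -ler_pdivrMr.
have q0 : 0 < m.+1%:R `^ p / (2 / ln 2) `^ p :> R by rewrite divr_gt0.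
have lnp0 : 0 < ln n%:R `^ p :> R by apply: lt_le_trans ln_lbp.
have -> : (2 ^ m.+1)%:R = 2 * (2 ^ m)%:R :> R by rewrite expnS natrM.
apply: (@le_trans _ _ (a (2 ^ m.+1)%N /
    ((2 ^ m)%:R * (m.+1%:R `^ p / (2 / ln 2) `^ p)))).
  apply: ler_pM => //; first by rewrite invr_ge0 mulr_ge0 ?ltW.
    exact/a_homo/ltnW.
  rewrite lef_pV2 ?posrE ?(mulr_gt0 tm0 q0) ?(mulr_gt0 n0 lnp0)//.
  by apply: ler_pM; rewrite ?ler_nat// ltW.
rewrite le_eqVlt; apply/orP; left; apply/eqP.
move: (a _) => b; field.
by rewrite !gt_eqF.
Qed.

Lemma cvg0_of_dyadic (R : realType) (p : R) (a : nat -> R) :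
  0 <= p -> (forall k, 0 <= a k) -> {homo a : i j / (i <= j)%N >-> i <= j} ->
  (fun m => a (2 ^ m.+1)%N / ((2 ^ m.+1)%:R * m.+1%:R `^ p)) @ \oo -->
    (0 : R) ->
  (fun n => a n / (n%:R * ln n%:R `^ p)) @ \oo --> (0 : R).
Proof.
move=> p0 a0 a_homo.
set z := (fun m => a _ / _) => z0.
have tlog : trunc_log 2 n @[n --> \oo] --> \oo.
  apply/cvgnyPge => A; near=> n.
  by apply: trunc_log_max => //; near: n; exact: nbhs_infty_ge.
have zt : z (trunc_log 2 n) @[n --> \oo] --> 0 by exact: cvg_comp tlog z0.
apply: (@squeeze_cvgr _ _ _ _ (cst 0)
    (fun n => 2 * (2 / ln 2) `^ p * z (trunc_log 2 n))).
- near=> n.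
  have n2 : (1 < n)%N by near: n; exact: nbhs_infty_ge.
  rewrite divr_ge0// ?mulr_ge0 ?powR_ge0//= /z dyadic_bound//.
    by rewrite trunc_log_gt0.
  by apply: trunc_log_bounds => //; exact: ltnW.
- exact: cvg_cst.
- by rewrite -[X in _ --> X](mulr0 (2 * (2 / ln 2) `^ p)); apply: cvgMr.
Unshelve. all: by end_near. Qed.

(** The sum of the negative parts of the first [n] functions of the sequence:
    with indices starting at 0, these are [X 0, ..., X n.-1]. *)
Definition sum_neg (T : Type) (R : realType) (X : nat -> T -> R) (n : nat)
    (w : T) : R :=
  \sum_(i < n) (X i)^\- w.

Lemma sum_neg_ge0 (T : Type) (R : realType) (X : nat -> T -> R) n w :
  0 <= sum_neg X n w.
Proof. by apply: sumr_ge0 => i _; exact: funrneg_ge0. Qed.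

Lemma sum_neg_homo (T : Type) (R : realType) (X : nat -> T -> R) w :
  {homo (sum_neg X)^~ w : i j / (i <= j)%N >-> i <= j}.
Proof.
move=> i j ij; rewrite /sum_neg -!(big_mkord xpredT (fun k => (X k)^\- w)).
rewrite (big_cat_nat _ ij)//= lerDl.
by apply: sumr_ge0 => k _; exact: funrneg_ge0.
Qed.

Lemma max_neg_partial_sum_le (T : Type) (R : realType) (X : nat -> T -> R) n w :
  max_neg_partial_sum X n w <= sum_neg X n w.
Proof.
rewrite /max_neg_partial_sum big_nat; apply: bigmax_le; first exact: sum_neg_ge0.
move=> k /andP[_ kn]; rewrite /funrpos ge_max sum_neg_ge0 andbT.
apply: le_trans (@sum_neg_homo _ _ X w k n kn).
rewrite /= /partial_sum -sumrN; apply: ler_sum => i _.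
by rewrite /funrneg le_max lexx.
Qed.

Lemma max_neg_partial_sum_ge0 (T : Type) (R : realType) (X : nat -> T -> R) n w :
  0 <= max_neg_partial_sum X n w.
Proof. exact: bigmax_ge_id. Qed.

(** Indeed [E X = E X^+ - E X^-]. *)
Lemma expectation_funrneg_le (d : measure_display) (T : measurableType d)
    (R : realType) (P : probability T R) (X : {RV P >-> R}) :
  (X : T -> R) \in Lfun P 1%E -> (0 <= 'E_P[X])%E ->
  (\int[P]_w ((X : T -> R)^\- w)%:E <= 'E_P[(X : T -> R)^\+])%E.
Proof.
move=> /Lfun1_integrable iX.
have := integrable_neg_fin_num measurableT iX.
have := integralE P setT (EFin \o X).
rewrite funerpos funerneg unlock => EX Xn_fin; rewrite /= in EX.
by rewrite EX sube_ge0// Xn_fin.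
Qed.

Lemma integral_sum_neg_le (d : measure_display) (T : measurableType d)
    (R : realType) (P : probability T R) (X : nat -> {RV P >-> R})
    (C : R) (n : nat) :
  (forall i, \int[P]_w ((X i : T -> R)^\- w)%:E <= C%:E)%E ->
  (\int[P]_w (sum_neg (fun k => X k : T -> R) n w)%:E <= (n%:R * C)%:E)%E.
Proof.
move=> XC; rewrite /sum_neg.
under eq_integral do rewrite -sumEFin.
rewrite ge0_integral_sum//; last 2 first.
- by move=> i; apply/measurable_EFinP/measurable_funrneg.
- by move=> i w _; rewrite lee_fin funrneg_ge0.
apply: (@le_trans _ _ (\sum_(i < n) C%:E)%E).
  by apply: lee_sum => i _; exact: XC.
by rewrite sumEFin sumr_const card_ord mulr_natl.
Qed.

Theorem corollary4p3 (d : measure_display) (T : measurableType d)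
    (R : realType) (P : probability T R) (X : nat -> {RV P >-> R})
    (X_integrable : forall k, (X k : T -> R) \in Lfun P 1%E)
    (X_associated : associated P (fun k => X k : T -> R))
    (EX_ge0 : forall k, (0 <= 'E_P[X k])%E)
    (sup_EXpos : (ereal_sup (range (fun i => 'E_P[(X i : T -> R)^\+])) < +oo)%E)
    (eps : R) (eps_gt0 : 0 < eps) :
  {ae P, forall w,
    (fun n : nat => max_neg_partial_sum (fun k => X k : T -> R) n w
                    / (n%:R * (ln n%:R) `^ (1 + eps))) @ \oo --> (0 : R)}.
Proof.
have p0 : 0 <= 1 + eps by rewrite addr_ge0// ltW.
set S := ereal_sup _ in sup_EXpos.
have EXS i : ('E_P[(X i : T -> R)^\+] <= S)%E.
  by apply: ereal_sup_ubound; exists i.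
(* [S] lies in [0, +oo), so [fine S] is its value as a real number. *)
have S0 : (0 <= S)%E.
  by apply: le_trans (EXS 0%N); apply: expectation_ge0 => w; exact: funrpos_ge0.
have SE : S = (fine S)%:E by rewrite fineK// ge0_fin_numE.
have XC i : (\int[P]_w ((X i : T -> R)^\- w)%:E <= (fine S)%:E)%E.
  by rewrite -SE; apply: le_trans (EXS i); exact: expectation_funrneg_le.
set A := sum_neg (fun k => X k : T -> R).
pose c m : R := (2 ^ m.+1)%:R * m.+1%:R `^ (1 + eps).
have c0 m : 0 < c m by rewrite mulr_gt0 ?powR_gt0// ltr0n expn_gt0.
have mA n : measurable_fun setT (A n).
  by apply: measurable_sum => i; exact: measurable_funrneg.
(* The convergence along powers of two; the index is shifted by one so that
   [m.+1] never vanishes. *)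
have : {ae P, forall w, (fun m => A (2 ^ m.+1)%N w / c m) @ \oo --> (0 : R)}.
  apply: (@ae_cvg0_of_summable_integrals _ _ _ P _
    (fun m => fine S * (m.+1%:R `^ (1 + eps))^-1) (fine S * (1 + eps^-1))).
  - by move=> m; apply: measurable_funM => //; exact: measurable_cst.
  - by move=> m w; rewrite divr_ge0 ?sum_neg_ge0// ltW.
  - move=> m.
    under eq_integral do rewrite mulrC EFinM.
    rewrite ge0_integralZl_EFin//; last 3 first.
    + by move=> w _; rewrite lee_fin sum_neg_ge0.
    + exact/measurable_EFinP.
    + by rewrite invr_ge0 ltW.
    apply: (@le_trans _ _ ((c m)^-1%:E * ((2 ^ m.+1)%:R * fine S)%:E)%E).
      by rewrite lee_pmul2l ?lte_fin ?invr_gt0//; exact: integral_sum_neg_le.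
    rewrite -EFinM lee_fin le_eqVlt; apply/orP; left; apply/eqP.
    rewrite /c; move: (fine S) => s; field.
    by rewrite !gt_eqF ?powR_gt0// ltr0n expn_gt0.
  - move=> n; rewrite -mulr_sumr ler_wpM2l ?fine_ge0//.
    exact: sum_powRN_le.
apply: filterS => w /(cvg0_of_dyadic p0 (fun n => sum_neg_ge0 _ n w)
  (@sum_neg_homo _ _ _ w)) Acvg.
apply: (squeeze_cvgr _ (cvg_cst 0) Acvg); near=> n.
have d0 : 0 <= (n%:R * ln n%:R `^ (1 + eps))^-1 :> R.
  by rewrite invr_ge0 mulr_ge0 ?powR_ge0.
by rewrite mulr_ge0 ?max_neg_partial_sum_ge0//= ler_wpM2r ?max_neg_partial_sum_le.
Unshelve. all: by end_near. Qed.
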